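(* Over a field $F$ of characteristic zero there exist finite-dimensional simple algebras $A$ with unit element whose PI-exponent $\exp(A)=\lim_{n\to\infty}\sqrt[n]{c_n(A)}$ exists, is not an integer, and is strictly less than $\dim_F A$.
   Context: Algebras are not assumed associative. Codimensions: $F\{X\}$ is the free nonassociative $F$-algebra on a countable set $X=\{x_1,x_2,\ldots\}$; a polynomial $f(x_1,\ldots,x_n)\in F\{X\}$ is an identity of an algebra $A$ if $f(a_1,\ldots,a_n)=0$ for all $a_1,\ldots,a_n\in A$; $Id(A)$ is the ideal of all identities of $A$; $P_n\subset F\{X\}$ is the subspace of all polynomials multilinear in $x_1,\ldots,x_n$; and $c_n(A)=\dim_F \frac{P_n}{P_n\cap Id(A)}$. ''Fractional'' means not an integer. *)

(* Defs.v *)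
From HB Require Import structures.
From mathcomp Require Import all_boot all_order all_algebra.
From mathcomp Require Import finmap.
From mathcomp Require Import monalg.
From mathcomp Require Import all_classical all_reals all_analysis.

Set Implicit Arguments.
Unset Strict Implicit.
Unset Printing Implicit Defensive.

Import Order.TTheory GRing.Theory Num.Theory.
Import numFieldNormedType.Exports.

Local Open Scope ring_scope.
Local Open Scope classical_set_scope.

(* Nonassociative monomials in countably many variables, i.e. the free magma:
   Var i stands for the variable x_(i+1). *)
Inductive monomial := Var of nat | Mul of monomial & monomial.

Fixpoint tree_of_monomial (t : monomial) : GenTree.tree nat :=
  match t with
  | Var i => GenTree.Leaf i
  | Mul s u => GenTree.Node 0 [:: tree_of_monomial s; tree_of_monomial u]
  end.

Fixpoint monomial_of_tree (t : GenTree.tree nat) : monomial :=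
  match t with
  | GenTree.Leaf i => Var i
  | GenTree.Node _ [:: s; u] => Mul (monomial_of_tree s) (monomial_of_tree u)
  | GenTree.Node _ _ => Var 0
  end.

Lemma tree_of_monomialK : cancel tree_of_monomial monomial_of_tree.
Proof. by elim=> //= s -> t ->. Qed.

HB.instance Definition _ :=
  Countable.copy monomial (can_type tree_of_monomialK).

Fixpoint vars (t : monomial) : seq nat :=
  match t with
  | Var i => [:: i]
  | Mul s u => vars s ++ vars u
  end.

(* The vector space F{X} with its basis of nonassociative monomials.  The
   magma has no unit, so the (unital, associative) algebra structure that
   monalg puts on {malg F[K]} for a monoid K does not apply: only the vector
   space structure is used. *)
Definition free_nonassoc (F : fieldType) : lmodType F := {malg F[monomial]}.

(* P_n: every monomial of f involves each of x_1, ..., x_n exactly once and no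
   other variable. *)
Definition multilinear_polys (F : fieldType) (n : nat) :
    set (free_nonassoc F) :=
  [set f | forall t, t \in msupp f -> perm_eq (vars t) (iota 0 n)].
Arguments multilinear_polys F n : clear implicits.

(* The dimension of U / W for subspaces W of U in V.  The vectors b_0, ...,
   b_(d-1) represent a basis of U / W when every v in U is congruent modulo W
   to exactly one of their linear combinations; the value is the default 0
   if U / W is infinite-dimensional. *)
Definition basis_mod (F : fieldType) (V : lmodType F) (U W : set V) (d : nat)
    (b : 'I_d -> V) : Prop :=
  (forall i, U (b i)) /\
  (forall v, U v -> exists! c : 'rV[F]_d, W (v - \sum_(i < d) c 0 i *: b i)).

Definition dim_mod (F : fieldType) (V : lmodType F) (U W : set V) : nat :=
  xget 0%N [set d | exists b : 'I_d -> V, basis_mod U W b].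

(* A nonassociative algebra over F is a vector space A together with a bilinear
   product mul on A. *)
Section Algebra.
Variables (F : fieldType) (A : vectType F) (mul : {bilinear A -> A -> A}).

Definition unital : Prop :=
  exists e : A, forall x, mul e x = x /\ mul x e = x.

Definition two_sided_ideal (I : {vspace A}) : Prop :=
  forall a x, x \in I -> mul a x \in I /\ mul x a \in I.

Definition simple_algebra : Prop :=
  (exists x y, mul x y <> 0) /\
  (forall I : {vspace A}, two_sided_ideal I -> I = 0%VS \/ I = fullv).

Fixpoint monomial_eval (a : nat -> A) (t : monomial) : A :=
  match t with
  | Var i => a i
  | Mul s u => mul (monomial_eval a s) (monomial_eval a u)
  end.

Definition poly_eval (a : nat -> A) (f : free_nonassoc F) : A :=
  \sum_(t <- msupp f) f@_t *: monomial_eval a t.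

Definition identities : set (free_nonassoc F) :=
  [set f | forall a : nat -> A, poly_eval a f = 0].

Definition codimension (n : nat) : nat :=
  dim_mod (multilinear_polys F n) (multilinear_polys F n `&` identities).

(* The n-th root of c_n; the value at n = 0 is irrelevant to the limit. *)
Definition codim_root (R : realType) (n : nat) : R :=
  (codimension n)%:R `^ n%:R^-1.

Definition PIexp (R : realType) : R := limn (codim_root R).

End Algebra.

(* Main.v *)
From HB Require Import structures.
Require Import Defs.
From mathcomp Require Import all_boot all_order all_algebra.
From mathcomp Require Import finmap.
From mathcomp Require Import monalg.
From mathcomp Require Import all_classical all_reals all_analysis.
From mathcomp Require Import zify ring lra.
Set Implicit Arguments.
Unset Strict Implicit.
Unset Printing Implicit Defensive.
Import Order.TTheory GRing.Theory Num.Theory.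
Import numFieldNormedType.Exports.
Local Open Scope ring_scope.
Local Open Scope classical_set_scope.

(* Let A have basis 1, a, b, c, with unit 1 and ab = 1, ca = b, all other
   products of a, b, c being zero.  It is simple, and graded by the degrees
   0, -1, 1, 2.  A multilinear polynomial is determined by its values at words in
   the basis, and these vanish unless the degree of the word is between -1 and 2;
   weighting words by t^degree, this bounds c_n by a constant times
   (1 + 1/t + t + t^2)^n for every t in (0, 1].  Conversely, read a word as a
   walk in which a goes one step up, b one down and c two down.  In a walk from 0
   to 0 that never becomes negative, each b can be matched with an earlier a and
   each c with two earlier a's, which gives a product of single variables and
   commutators [x_j, x_i], [x_k, [x_i, x_j]].  Since commutators vanish on 1, the
   matrix of values of these products at the words is triangular, so c_n is at
   least the number of walks.  Both counts grow like rate^n for the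
   minimum rate of 1 + 1/t + t + t^2, and 3 < rate < 4. *)

(** * Quotient dimensions through coordinate functionals *)

Section DimMod.
Variables (F : fieldType) (V : lmodType F) (U W : set V) (T : finType).
Variable phi : T -> V -> F.
Hypothesis phi_lin : forall x, scalar (phi x).
Hypothesis U0 : U 0.
Hypothesis U_lin : forall a u v, U u -> U v -> U (a *: u + v).
(** Hence [U / W] embeds in the space of functions on [T], and its dimension is governed by ranks of
    matrices. *)
Hypothesis UW : forall v, U v -> W v <-> forall x, phi x v = 0.

Let coords v : 'rV[F]_#|T| := \row_j phi (enum_val j) v.

Let coords_is_linear : linear coords.
Proof. by move=> a u v; apply/rowP => j; rewrite !mxE phi_lin. Qed.

HB.instance Definition _ :=
  GRing.isLinear.Build F V 'rV[F]_#|T| _ coords coords_is_linear.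

Let coords_mx d (b : 'I_d -> V) := \matrix_(i < d) coords (b i).

Let coords_comb d (b : 'I_d -> V) (c : 'rV_d) :
  coords (\sum_(i < d) c 0 i *: b i) = c *m coords_mx b.
Proof.
rewrite linear_sum mulmx_sum_row; apply: eq_bigr => i _.
by rewrite linearZ rowK.
Qed.

Let U_comb d (b : 'I_d -> V) (c : 'rV_d) :
  (forall i, U (b i)) -> U (\sum_(i < d) c 0 i *: b i).
Proof.
by move=> Ub; elim/big_ind: _ => // [u v Uu Uv|i _];
  [rewrite -[u]scale1r; apply: U_lin|rewrite -[_ *: _]addr0; apply: U_lin].
Qed.

Let W_coords v : U v -> W v <-> coords v = 0.
Proof.
move=> /UW ->; split=> [v0|/rowP v0 x]; first by apply/rowP => j; rewrite !mxE.
by have := v0 (enum_rank x); rewrite !mxE enum_rankK.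
Qed.

Let W_sub d (b : 'I_d -> V) (c : 'rV_d) v : (forall i, U (b i)) -> U v ->
  W (v - \sum_(i < d) c 0 i *: b i) <-> coords v = c *m coords_mx b.
Proof.
move=> Ub Uv; rewrite W_coords; last first.
  by rewrite addrC -scaleN1r; apply: U_lin => //; exact: U_comb.
rewrite linearB /= coords_comb.
by split=> [/eqP|->]; [rewrite subr_eq0 => /eqP|rewrite subrr].
Qed.

Let basis_mod_free d (b : 'I_d -> V) : basis_mod U W b ->
  row_free (coords_mx b).
Proof.
move=> [Ub Eb]; apply: inj_row_free => c cb0.
have [c' [_ uniq_c]] := Eb 0 U0.
have W0 x : x *m coords_mx b = 0 -> c' = x.
  by move=> x0; apply/uniq_c/W_sub => //; rewrite linear0.
by rewrite -(W0 c cb0); apply: W0; rewrite mul0mx.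
Qed.

Let basis_mod_full d (b : 'I_d -> V) v : basis_mod U W b -> U v ->
  (coords v <= coords_mx b)%MS.
Proof.
by move=> [Ub Eb] Uv; have [c [/W_sub-> // _]] := Eb v Uv; exact: submxMl.
Qed.

(** A family in [U] with independent coordinate rows has length at most [#|T|]; one of maximal
    length is a basis. So [dim_mod] is a true dimension and not its default 0. *)
Let ex_basis_mod : exists d, exists b : 'I_d -> V, basis_mod U W b.
Proof.
pose P d := `[< exists b : 'I_d -> V,
  (forall i, U (b i)) /\ row_free (coords_mx b) >].
have P0 : exists d, P d.
  exists 0%N; apply/asboolP; exists (fun=> 0); split=> //.
  by rewrite /row_free eqn_leq rank_leq_row.
have P_le d : P d -> (d <= #|T|)%N.
  by move=> /asboolP[b [_ /eqP <-]]; exact: rank_leq_col.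
have [d /asboolP[b [Ub freeb]] maxd] := ex_maxnP P0 P_le.
exists d, b; split=> // v Uv.
suff /submxP[c cE] : (coords v <= coords_mx b)%MS.
  exists c; split=> [|c' /W_sub E]; first exact/W_sub.
  by apply: (row_free_inj freeb); rewrite -E.
(* Outside the row space, [v] would extend the family to length [d.+1]. *)
apply: contraT => vNb.
suff /maxd : P d.+1 by rewrite ltnn.
apply/asboolP; exists (fun i => oapp b v (unlift ord0 i)); split=> [i|].
  by case: unlift.
apply: inj_row_free => c.
rewrite mulmx_sum_row big_ord_recl rowK unlift_none /= => E.
have {E} E : c 0 ord0 *: coords v
    + (\row_j c 0 (lift ord0 j)) *m coords_mx b = 0.
  rewrite -[RHS]E mulmx_sum_row; congr (_ + _); apply: eq_bigr => i _.
  by rewrite mxE !rowK liftK.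
have c0 : c 0 ord0 = 0.
  apply: contraNeq vNb => c0; apply/submxP.
  exists (- (c 0 ord0)^-1 *: (\row_j c 0 (lift ord0 j))).
  apply: (scalerI c0); rewrite -scalemxAl scalerA mulrN divff // scaleN1r.
  by apply/eqP; rewrite -addr_eq0 E.
move: E; rewrite c0 scale0r add0r => E.
have /rowP r0 : \row_j c 0 (lift ord0 j) = 0.
  by apply: (row_free_inj freeb); rewrite E mul0mx.
apply/rowP => i; rewrite mxE; case: (unliftP ord0 i) => [j ->|-> //].
by have := r0 j; rewrite !mxE.
Qed.

Let basis_dim_mod : exists b : 'I_(dim_mod U W) -> V, basis_mod U W b.
Proof. exact: xgetPex ex_basis_mod. Qed.

Lemma dim_mod_le_card : (dim_mod U W <= #|T|)%N.
Proof.
have [b /basis_mod_free /eqP <-] := basis_dim_mod.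
exact: rank_leq_col.
Qed.

Lemma free_le_dim_mod m (g : 'I_m -> V) : (forall i, U (g i)) ->
  (forall c : 'I_m -> F,
     (forall x, \sum_i c i * phi x (g i) = 0) -> forall i, c i = 0) ->
  (m <= dim_mod U W)%N.
Proof.
move=> Ug freeg; have [b bB] := basis_dim_mod.
have /eqP <- : row_free (coords_mx g).
  apply: inj_row_free => c /rowP c0; apply/rowP => i; rewrite mxE.
  apply: (freeg (c 0)) => x; have := c0 (enum_rank x); rewrite !mxE => E.
  by rewrite -[RHS]E; apply: eq_bigr => j _; rewrite !mxE enum_rankK.
apply: leq_trans (rank_leq_row (coords_mx b)); apply: mxrankS.
by apply/row_subP => i; rewrite rowK; exact: basis_mod_full.
Qed.

End DimMod.

(** At an index [i] minimizing [mu] among those with [c i != 0], the equation for column [i] retains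
    only its diagonal term. *)
Lemma triangular_free (F : fieldType) m (M : 'I_m -> 'I_m -> F)
    (mu : 'I_m -> nat) :
  (forall i, M i i != 0) ->
  (forall i j, M i j != 0 -> i = j \/ (mu i < mu j)%N) ->
  forall c : 'I_m -> F,
    (forall j, \sum_i c i * M i j = 0) -> forall i, c i = 0.
Proof.
move=> Mii Mij c cM0 i0; apply/eqP/negPn/negP => ci0.
case: (@arg_minnP _ i0 (fun i => c i != 0) mu ci0) => i ci mini.
have := cM0 i; rewrite (bigD1 i) //= big1 ?addr0; last first.
  move=> j ji; apply/eqP; rewrite mulf_eq0 -implyNb; apply/implyP => cj.
  apply: contraT => /Mij[E|]; first by rewrite E eqxx in ji.
  by rewrite ltnNge mini.
by move/eqP; rewrite mulf_eq0 (negPf ci) (negPf (Mii i)).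
Qed.

(** * Evaluation of multilinear polynomials *)

Section PolyEval.
Variables (F : fieldType) (A : vectType F) (mul : {bilinear A -> A -> A}).
Local Notation mono := (monomial_eval mul).
Local Notation eval := (poly_eval mul).
Local Notation multilinear := (multilinear_polys F).

Lemma monomial_eval_ext a a' t :
  (forall i, i \in vars t -> a i = a' i) -> mono a t = mono a' t.
Proof.
elim: t => [i|t IHt u IHu] /= aa'; first by rewrite aa' ?inE.
by rewrite IHt ?IHu // => i ti; rewrite aa' // mem_cat ti ?orbT.
Qed.

Lemma poly_evalEw a f (d : {fset monomial}) : (msupp f `<=` d)%fset ->
  eval a f = \sum_(t <- d) f@_t *: mono a t.
Proof.
move=> fd; rewrite /poly_eval (big_fset_incl _ fd) // => t td.
by move/mcoeff_outdom => ->; rewrite scale0r.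
Qed.

Lemma poly_eval_is_linear a : linear (eval a).
Proof.
move=> c f g; set d := (msupp f `|` msupp g)%fset.
have dE h : (msupp h `<=` d)%fset -> eval a h = _ := @poly_evalEw a h d.
rewrite (dE f) ?fsubsetUl // (dE g) ?fsubsetUr // (dE (c *: f + g)).
  rewrite scaler_sumr -big_split; apply: eq_bigr => t _ /=.
  by rewrite mcoeffD mcoeffZ scalerDl scalerA.
apply: fsubset_trans (msuppD_le _ _) _.
by rewrite fsetSU // msuppZ_le.
Qed.

HB.instance Definition _ a :=
  GRing.isLinear.Build F (free_nonassoc F) A _ (eval a)
    (poly_eval_is_linear a).

Lemma poly_evalU a t : eval a << t >> = mono a t.
Proof.
by rewrite /poly_eval msuppU oner_eq0 big_seq_fset1 mcoeffUU scale1r.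
Qed.

Lemma multilinear_polys0 n : multilinear n 0.
Proof. by move=> t; rewrite msupp0. Qed.

Lemma multilinear_polys_lin n c f g :
  multilinear n f -> multilinear n g -> multilinear n (c *: f + g).
Proof.
move=> fn gn t /(fsubsetP (msuppD_le _ _)); rewrite inE => /orP[|/gn//].
by move=> /(fsubsetP (msuppZ_le _ _)) /fn.
Qed.

Lemma multilinear_polysU n t : perm_eq (vars t) (iota 0 n) ->
  multilinear n << t >>.
Proof. by move=> tn u; rewrite msuppU oner_eq0 inE => /eqP->. Qed.

Lemma poly_eval_ext n a a' f : multilinear n f ->
  (forall i, (i < n)%N -> a i = a' i) -> eval a f = eval a' f.
Proof.
move=> fn aa'; rewrite /poly_eval !big_seq; apply: eq_bigr => t /fn tn.
congr (_ *: _); apply: monomial_eval_ext => i.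
by rewrite (perm_mem tn) mem_iota add0n => /aa'.
Qed.

Let upd (a : nat -> A) j x i := if i == j then x else a i.

Let monomial_eval_upd0 a j x y t : j \notin vars t ->
  mono (upd a j x) t = mono (upd a j y) t.
Proof.
move=> jt; apply: monomial_eval_ext => i it; rewrite /upd.
by case: eqP => // ij; rewrite -ij it in jt.
Qed.

(** As [j] occurs once in [t], exactly one factor of each product containing it depends on its
    value, and bilinearity lets the sum through. *)
Let monomial_eval_upd a j (I : finType) (c : I -> F) (x : I -> A) t :
  count_mem j (vars t) = 1%N ->
  mono (upd a j (\sum_k c k *: x k)) t = \sum_k c k *: mono (upd a j (x k)) t.
Proof.
elim: t => [i|t IHt u IHu] /=.
  by rewrite addn0 /upd; case: (i == j).
rewrite count_cat; case tj : (count_mem j (vars t)) => [|[|m]] //.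
- rewrite add0n => uj; rewrite IHu // linear_sumr.
  apply: eq_bigr => k _; rewrite linearZr_LR /=; congr (_ *: mul _ _).
  by apply: monomial_eval_upd0; apply/count_memPn.
- rewrite add1n => -[/count_memPn uj]; rewrite IHt // linear_sumlz.
  apply: eq_bigr => k _; rewrite linearZl_LR /=; congr (_ *: mul _ _).
  exact: monomial_eval_upd0.
Qed.

Let poly_eval_upd n a j (I : finType) (c : I -> F) (x : I -> A) f :
  multilinear n f -> (j < n)%N ->
  eval (upd a j (\sum_k c k *: x k)) f = \sum_k c k *: eval (upd a j (x k)) f.
Proof.
move=> fn jn; rewrite /poly_eval.
under [RHS]eq_bigr do rewrite scaler_sumr.
rewrite exchange_big [LHS]big_seq [RHS]big_seq; apply: eq_bigr => t /fn tn /=.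
rewrite monomial_eval_upd; last first.
  by rewrite (permP tn) count_uniq_mem ?iota_uniq // mem_iota add0n jn.
by rewrite scaler_sumr; apply: eq_bigr => k _; rewrite !scalerA mulrC.
Qed.

Lemma identities_basis n (I : finType) (i0 : I) (e : I -> A) f :
  (forall x, exists c : I -> F, x = \sum_k c k *: e k) ->
  multilinear n f -> (forall w : nat -> I, eval (e \o w) f = 0) ->
  identities mul f.
Proof.
move=> e_span fn ef.
(* Variables are freed one at a time: the first [j] take arbitrary values, the others basis
   vectors. *)
suff H j : (j <= n)%N -> forall a,
    (forall i, (j <= i < n)%N -> exists k, a i = e k) -> eval a f = 0.
  by move=> a; apply: (H n) => // i; rewrite ltnNge andbN.
elim: j => [_ a ae|j IH jn a ae].
  have /choice[w wE] : forall i, exists k, (i < n)%N -> a i = e k.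
    move=> i; case: (ltnP i n) => [/ae[k ak]|_]; last by exists i0.
    by exists k.
  by rewrite (@poly_eval_ext n _ (e \o w) _ fn).
have [c cE] := e_span (a j).
have -> : eval a f = eval (upd a j (\sum_k c k *: e k)) f.
  apply: (poly_eval_ext fn) => i _; rewrite /upd -cE.
  by case: eqP => [->|].
rewrite (poly_eval_upd _ _ _ fn) //; apply: big1 => k _.
rewrite IH ?scaler0 // 1?ltnW // => i /andP[ji ni]; rewrite /upd.
case: eqP => [_|/eqP ij]; first by exists k.
by apply: ae; rewrite ni andbT ltn_neqAle eq_sym ij.
Qed.

(** Functions induced by multilinear polynomials in the variables [s]. Lists of scaled monomials
    multiply directly, while [free_nonassoc] is only a vector space. *)
Definition poly_fun (s : seq nat) (g : (nat -> A) -> A) :=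
  exists2 l : seq (F * monomial),
    forall ct, ct \in l -> perm_eq (vars ct.2) s
    & forall a, g a = \sum_(ct <- l) ct.1 *: mono a ct.2.

Lemma poly_fun_ext s g g' : g =1 g' -> poly_fun s g -> poly_fun s g'.
Proof. by move=> gg' [l ls lE]; exists l => // a; rewrite -gg' lE. Qed.

Lemma poly_fun_perm s s' g : perm_eq s s' -> poly_fun s g -> poly_fun s' g.
Proof.
by move=> ss' [l ls lE]; exists l => // ct /ls /perm_trans; apply.
Qed.

Lemma poly_fun_var i : poly_fun [:: i] (fun a => a i).
Proof.
exists [:: (1, Var i)] => [ct|a]; first by rewrite inE => /eqP->.
by rewrite big_seq1 scale1r.
Qed.

Lemma poly_funM s1 s2 g1 g2 : poly_fun s1 g1 -> poly_fun s2 g2 ->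
  poly_fun (s1 ++ s2) (fun a => mul (g1 a) (g2 a)).
Proof.
move=> [l1 ls1 lE1] [l2 ls2 lE2].
exists [seq (x.1 * y.1, Mul x.2 y.2) | x <- l1, y <- l2].
  by move=> ct /allpairsP[[x y] [/ls1 px /ls2 py ->]] /=; apply: perm_cat.
move=> a; rewrite big_allpairs_dep lE1 lE2 linear_sumlz.
apply: eq_bigr => x _ /=.
rewrite linear_sumr; apply: eq_bigr => y _ /=.
by rewrite linearZl_LR linearZr_LR /= scalerA.
Qed.

Lemma poly_funB s g1 g2 : poly_fun s g1 -> poly_fun s g2 ->
  poly_fun s (fun a => g1 a - g2 a).
Proof.
move=> [l1 ls1 lE1] [l2 ls2 lE2].
exists (l1 ++ [seq (- x.1, x.2) | x <- l2]).
  by move=> ct; rewrite mem_cat => /orP[/ls1//|/mapP[x /ls2 px ->]].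
move=> a; rewrite big_cat big_map /= lE1 lE2 -sumrN; congr (_ + _).
by apply: eq_bigr => x _; rewrite scaleNr.
Qed.

Lemma poly_fun_multilinear n g : poly_fun (iota 0 n) g ->
  exists2 f, multilinear n f & forall a, eval a f = g a.
Proof.
move=> [l ln lE].
exists (\sum_(ct <- l) ct.1 *: (<< ct.2 >> : free_nonassoc F)) => [|a].
  rewrite big_seq; elim/big_ind: _ => [|f1 f2 f1n f2n|ct /ln ctn].
  - exact: multilinear_polys0.
  - by rewrite -[f1]scale1r; apply: multilinear_polys_lin.
  rewrite -[_ *: _]addr0; apply: multilinear_polys_lin.
    exact: multilinear_polysU.
  exact: multilinear_polys0.
rewrite linear_sum lE; apply: eq_bigr => ct _.
by rewrite linearZ /= poly_evalU.
Qed.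

End PolyEval.

(** * The four-dimensional algebra and the upper bound for its codimensions *)

Definition l1 : 'I_4 := @Ordinal 4 0 isT.
Definition la : 'I_4 := @Ordinal 4 1 isT.
Definition lb : 'I_4 := @Ordinal 4 2 isT.
Definition lc : 'I_4 := @Ordinal 4 3 isT.

Lemma letter_ind (P : 'I_4 -> Prop) :
  P l1 -> P la -> P lb -> P lc -> forall k, P k.
Proof.
move=> P1 Pa Pb Pc k; have : val k \in iota 0 4 by rewrite mem_iota ltn_ord.
by rewrite !inE => /or4P[] /eqP kE;
  [move: P1|move: Pa|move: Pb|move: Pc]; congr P; apply/val_inj.
Qed.

Section Algebra4.
Variable F : fieldType.
Notation A := 'rV[F]_4.
Implicit Types x y : A.

Definition mul4 x y : A := \row_k
  [:: x 0 l1 * y 0 l1 + x 0 la * y 0 lb;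
      x 0 l1 * y 0 la + x 0 la * y 0 l1;
      x 0 l1 * y 0 lb + x 0 lb * y 0 l1 + x 0 lc * y 0 la;
      x 0 l1 * y 0 lc + x 0 lc * y 0 l1]`_k.

Lemma row4P x y : x 0 l1 = y 0 l1 -> x 0 la = y 0 la -> x 0 lb = y 0 lb ->
  x 0 lc = y 0 lc -> x = y.
Proof. by move=> *; apply/rowP; apply: letter_ind. Qed.

Lemma mul4_is_bilinear : bilinear_for *:%R *:%R mul4.
Proof.
by split=> [y c x x'|x c y y']; apply: row4P; rewrite !mxE /=; ring.
Qed.

HB.instance Definition _ :=
  bilinear_isBilinear.Build F A A A *:%R *:%R mul4 mul4_is_bilinear.

Definition e (k : 'I_4) : A := delta_mx 0 k.

Lemma eE k l : e k 0 l = (val l == val k)%:R.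
Proof. by rewrite mxE eqxx. Qed.

Lemma e_span x : x = \sum_k x 0 k *: e k.
Proof. exact: row_sum_delta. Qed.

Let mulE := (mxE, eE).

Lemma mul4_unital : unital mul4.
Proof.
by exists (e l1) => x; split; apply: row4P; rewrite !mulE /=; ring.
Qed.

(** An ideal containing [b] contains [ab = 1]. Multiplying a nonzero element by [a] or [b] on
    suitable sides isolates a nonzero multiple of [b]. *)
Lemma mul4_simple : simple_algebra mul4.
Proof.
split.
  exists (e l1), (e l1) => /rowP/(_ l1); rewrite !mulE /= mulr1 mulr0 addr0.
  exact/eqP/oner_neq0.
move=> I idI; have [->|I0] := eqVneq I 0%VS; [by left|right].
have IL c x : c != 0 -> c *: x \in I -> x \in I.
  by move=> c0 /(memvZ c^-1); rewrite scalerA mulVf // scale1r.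
suff Ib : e lb \in I.
  have I1 : e l1 \in I.
    have [+ _] := idI (e la) _ Ib; congr (_ \in I).
    by apply: row4P; rewrite !mulE /=; ring.
  apply/vspaceP => x; rewrite memvf; have [+ _] := idI x _ I1.
  by congr (_ \in I); apply: row4P; rewrite !mulE /=; ring.
(* The product [b(xb)] is [b] scaled by the [a]-coordinate of [x]. *)
have Ia x : x \in I -> x 0 la != 0 -> e lb \in I.
  move=> Ix xa; apply: (IL _ _ xa).
  have [+ _] := idI (e lb) _ (idI (e lb) _ Ix).2; congr (_ \in I).
  by apply: row4P; rewrite !mulE /=; ring.
set x := vpick I; have Ix : x \in I := memv_pick I.
have x0 : x != 0 by rewrite vpick0.
have [xa|/(Ia _ Ix)//] := eqVneq (x 0 la) 0.
have [x1|x1] := eqVneq (x 0 l1) 0; last first.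
  by apply: (Ia _ (idI (e la) _ Ix).1); rewrite !mulE /= mul0r mul1r add0r.
have [xc|xc] := eqVneq (x 0 lc) 0; last first.
  apply: (IL _ _ xc); have [_ +] := idI (e la) _ Ix; congr (_ \in I).
  by apply: row4P; rewrite !mulE /= ?x1 ?xa; ring.
have xE : x = x 0 lb *: e lb.
  by apply: row4P; rewrite !mulE /= ?x1 ?xa ?xc; ring.
apply: (IL (x 0 lb)); last by rewrite -xE.
by apply: contraNneq x0 => xb; rewrite xE xb scale0r.
Qed.

(* The grading 1, a, b, c of degrees 0, -1, 1, 2, shifted by one to stay in
   [nat]. *)
Definition wt (k : 'I_4) : nat := nth 0%N [:: 1; 0; 2; 3]%N k.

(** Every nonzero product of basis vectors adds degrees; the successor compensates for the shift in
    [wt]. *)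
Lemma mul4_graded x y k : mul4 x y 0 k != 0 ->
  exists i j, [/\ x 0 i != 0, y 0 j != 0 & (wt i + wt j = (wt k).+1)%N].
Proof.
have D (p q : F) : p + q != 0 -> p != 0 \/ q != 0.
  by have [->|] := eqVneq p 0; [rewrite add0r; right|left].
have M i j : x 0 i * y 0 j != 0 -> (wt i + wt j = (wt k).+1)%N ->
    exists i j, [/\ x 0 i != 0, y 0 j != 0 & (wt i + wt j = (wt k).+1)%N].
  by rewrite mulf_eq0 negb_or => /andP[xi yj] E; exists i, j.
move: k M; apply: letter_ind => M; rewrite mxE /=.
- by case/D => /M; apply.
- by case/D => /M; apply.
- by case/D => [/D[]|] /M; apply.
- by case/D => /M; apply.
Qed.

Lemma monomial_eval_graded (w : nat -> 'I_4) t k :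
  monomial_eval mul4 (e \o w) t 0 k != 0 ->
  (\sum_(i <- vars t) wt (w i) + 1 = wt k + size (vars t))%N.
Proof.
elim: t k => [i|t IHt u IHu] k /=.
  rewrite big_seq1 eE; case: (eqVneq (val k) (val (w i))) => [/val_inj->//|_].
  by rewrite eqxx.
move=> /mul4_graded[i [j [/IHt + /IHu]]].
rewrite big_cat size_cat /=; lia.
Qed.

Lemma poly_eval_graded n f (w : nat -> 'I_4) k : multilinear_polys F n f ->
  poly_eval mul4 (e \o w) f 0 k != 0 ->
  (\sum_(0 <= i < n) wt (w i) + 1 = wt k + n)%N.
Proof.
move=> fn; apply: contra_neq_eq => neq.
rewrite /poly_eval summxE big_seq big1 // => t /fn tn.
rewrite mxE [X in _ * X](_ : _ = 0) ?mulr0 //.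
apply: contra_neq_eq neq => /monomial_eval_graded.
by rewrite (perm_big _ tn) (perm_size tn) size_iota /index_iota subn0.
Qed.

(** The total weight of a word is its degree plus [n], so the bound says that the degree is at most
    2, the largest degree in the algebra. *)
Definition words n := {w : n.-tuple 'I_4 | (\sum_(l <- w) wt l <= n.+2)%N}.

(** For multilinear [f] the sum hides nothing: the word fixes the degree of the value and the
    letters have distinct degrees, so at most one coordinate is nonzero. *)
Definition word_eval n (w : words n) (f : free_nonassoc F) : F :=
  \sum_k poly_eval mul4 (e \o nth l1 (val w)) f 0 k.

Lemma word_eval_is_scalar n (w : words n) : scalar (word_eval w).
Proof.
move=> c f g; rewrite /word_eval linearP mulr_sumr -big_split /=.
by apply: eq_bigr => k _; rewrite !mxE.
Qed.

Lemma word_evalP n f : multilinear_polys F n f ->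
  (multilinear_polys F n `&` identities mul4) f <->
  forall w : words n, word_eval w f = 0.
Proof.
move=> fn; split=> [[_ f0] w|f0].
  by rewrite /word_eval f0; apply: big1 => k _; rewrite mxE.
split=> //; apply: (@identities_basis _ _ mul4 n _ l1 e) => // [x|w].
  by exists (x 0); exact: e_span.
pose s := [tuple w (val i) | i < n].
have sE i : (i < n)%N -> nth l1 s i = w i.
  by move=> ni; rewrite -(tnth_nth _ _ (Ordinal ni)) tnth_mktuple.
have -> : poly_eval mul4 (e \o w) f = poly_eval mul4 (e \o nth l1 s) f.
  by apply: (@poly_eval_ext _ _ _ n) => // i ni /=; rewrite sE.
have sumE : (\sum_(l <- s) wt l = \sum_(0 <= i < n) wt (nth l1 s i))%N.
  by rewrite (big_nth l1) size_tuple.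
apply/rowP => k; rewrite [RHS]mxE; apply/eqP/negPn/negP => fk.
have := poly_eval_graded fn fk; rewrite -sumE => wk.
have s_word : (\sum_(l <- s) wt l <= n.+2)%N.
  have : (wt k <= 3)%N by move: k {fk wk}; apply: letter_ind.
  lia.
have := f0 (exist _ s s_word); rewrite /word_eval (bigD1 k) //= big1.
  by move/eqP; rewrite addr0 (negPf fk).
move=> j jk; apply: contra_neq_eq jk => fj.
have := poly_eval_graded fn fj; rewrite -sumE => wj.
have : wt j = wt k by apply: (@addIn n); rewrite -wj -wk.
by move: (j) (k); apply: letter_ind; apply: letter_ind.
Qed.

Lemma codimension_mul4_le n : (codimension mul4 n <= #|{: words n}|)%N.
Proof.
apply: (@dim_mod_le_card _ _ _ _ _ (@word_eval n)).
- exact: word_eval_is_scalar.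
- exact: multilinear_polys0.
- exact: multilinear_polys_lin.
- exact: word_evalP.
Qed.

End Algebra4.

(** Expanding the power gives the sum of [t ^+ weight] over all words, and for [t <= 1] each counted
    word contributes at least [t ^+ n.+2]. *)
Lemma card_words_le (R : realFieldType) (t : R) n : 0 < t <= 1 ->
  #|{: words n}|%:R * t ^+ n.+2 <= (t + 1 + t ^+ 2 + t ^+ 3) ^+ n.
Proof.
move=> /andP[t0 t1].
have -> : (t + 1 + t ^+ 2 + t ^+ 3) ^+ n =
    \sum_(w : n.-tuple 'I_4) t ^+ (\sum_(l <- w) wt l)%N.
  transitivity (\prod_(i < n) \sum_l t ^+ wt l).
    by rewrite prodr_const card_ord !big_ord_recl big_ord0 /= addr0 !addrA.
  rewrite bigA_distr_bigA (reindex (@tuple_of_finfun _ n)) /=; last first.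
    exists (@finfun_of_tuple _ n) => x _.
      exact: tuple_of_finfunK.
    exact: finfun_of_tupleK.
  by apply: eq_bigr => f _; rewrite expr_sum big_map big_enum.
rewrite card_sig mulr_natl -sumr_const.
rewrite [leRHS](bigID (fun w => w \in [pred w : n.-tuple 'I_4 |
  (\sum_(l <- w) wt l <= n.+2)%N])) /=.
apply: ler_wpDr; first by apply: sumr_ge0 => w _; rewrite exprn_ge0 // ltW.
by apply: ler_sum => w; rewrite inE => wn; apply: ler_wiXn2l => //; exact: ltW.
Qed.

(** * Products of commutators attached to words *)

(** These encode a variable, a commutator [[x_j, x_i]] and a double commutator [[x_k,
    [x_i, x_j]]]. *)
Inductive factor :=
  | Single of nat
  | Pair of nat & nat
  | Triple of nat & nat & nat.

Definition positions f : seq nat :=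
  match f with
  | Single i => [:: i]
  | Pair j i => [:: j; i]
  | Triple k j i => [:: k; j; i]
  end.

(** The condition [j < i] makes swapping the letters at [j] and [i] increase [mass]. The position
    [k] is unconstrained, as a nonzero double commutator of basis vectors forces the letter [a]
    there. *)
Definition fits (w : nat -> 'I_4) f : bool :=
  match f with
  | Single i => w i == l1
  | Pair j i => [&& (j < i)%N, w j == la & w i == lb]
  | Triple k j i => [&& (j < i)%N, w k == la, w j == la & w i == lc]
  end.

Lemma eq_fits w w' f : {in positions f, w =1 w'} -> fits w f = fits w' f.
Proof.
by case: f => [i|j i|k j i] /= ww'; rewrite !ww' ?inE ?eqxx ?orbT.
Qed.

Lemma eq_all_fits w w' fs : {in flatten (map positions fs), w =1 w'} ->
  all (fits w) fs = all (fits w') fs.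
Proof.
elim: fs => //= f fs IH ww'.
by rewrite (@eq_fits w w') ?IH // => p pf; apply: ww'; rewrite mem_cat pf ?orbT.
Qed.

(* Chosen so that a nonzero value of a factor at letters other than those it
   fits has larger total mass: for a commutator this moves the letter [a] to a
   later position or replaces [b] by [c]. *)
Definition mass (i : nat) (l : 'I_4) : nat := nth 0%N [:: 0; i.+1; 1; 2]%N l.

Section Factors.
Variable F : fieldType.
Notation A := 'rV[F]_4.
Local Notation mul4 := (@mul4 F).
Local Notation e := (@e F).

Let mulE := (mxE, eE).

Definition comm (x y : A) : A := mul4 x y - mul4 y x.

Lemma commE x y : comm x y = \row_k
  [:: x 0 la * y 0 lb - y 0 la * x 0 lb; 0;
      x 0 lc * y 0 la - y 0 lc * x 0 la; 0]`_k.
Proof. by apply: row4P; rewrite !mulE /=; ring. Qed.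

(** A commutator has only coordinates along [1] and [b], and bracketing with [z] pairs the [b] part
    with the [a]-coordinate of [z]. *)
Lemma comm2E x y z : comm z (comm x y) =
  (z 0 la * (x 0 lc * y 0 la - y 0 lc * x 0 la)) *: e l1.
Proof. by rewrite !commE; apply: row4P; rewrite !mulE /=; ring. Qed.

Definition factor_eval (a : nat -> A) f : A :=
  match f with
  | Single i => a i
  | Pair j i => comm (a j) (a i)
  | Triple k j i => comm (a k) (comm (a i) (a j))
  end.

Lemma factor_eval_fits w f : fits w f -> factor_eval (e \o w) f = e l1.
Proof.
case: f => [i /eqP /= ->|j i /and3P[_ /eqP wj /eqP wi]|k j i] //=.
  by rewrite wj wi commE; apply: row4P; rewrite !mulE /=; ring.
case/and4P=> [_ /eqP wk /eqP wj /eqP wi]; rewrite wk wj wi comm2E.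
by apply: row4P; rewrite !mulE /=; ring.
Qed.

Lemma comm_e_neq0 p q : comm (e p) (e q) != 0 ->
  (p, q) \in [:: (la, lb); (lb, la); (lc, la); (la, lc)].
Proof.
apply: contraR; rewrite commE => pq; apply/eqP; move: p q pq.
by apply: letter_ind; apply: letter_ind => // _;
  apply: row4P; rewrite !mulE /=; ring.
Qed.

Lemma comm2_e_neq0 r p q : comm (e r) (comm (e p) (e q)) != 0 ->
  r = la /\ (p, q) \in [:: (lc, la); (la, lc)].
Proof.
rewrite comm2E => ne0; split.
  apply: contra_neq_eq ne0 => ra.
  suff -> : e r 0 la = 0 by rewrite mul0r scale0r.
  by rewrite eE; move: r ra; apply: letter_ind.
apply: contraR ne0 => pq; apply/eqP; rewrite -[RHS](scale0r (e l1)).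
congr (_ *: _); rewrite !eE; move: p q pq.
by apply: letter_ind; apply: letter_ind => //= _; ring.
Qed.

(** Only the few letter patterns with nonzero commutator have to be compared; a single position
    holding another letter than [1] already has positive mass. *)
Lemma factor_eval_mass w w' f : fits w f -> factor_eval (e \o w') f != 0 ->
  {in positions f, w =1 w'} \/
  (\sum_(p <- positions f) mass p (w p) <
   \sum_(p <- positions f) mass p (w' p))%N.
Proof.
case: f => [i|j i|k j i] /=.
- move=> /eqP wi _; rewrite !big_seq1 wi.
  have [w'i|] := eqVneq (w' i) l1.
    by left=> p; rewrite inE => /eqP->; rewrite wi.
  by move: (w' i); apply: letter_ind => // _; right.
- move=> /and3P[ji /eqP wj /eqP wi] /comm_e_neq0.
  rewrite !big_cons big_nil wj wi !inE => /or4P[] /eqP[w'j w'i];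
    rewrite w'j w'i; [left|right..]; try by rewrite /mass /=; lia.
  by move=> p; rewrite !inE => /orP[] /eqP->; rewrite ?wj ?wi.
- move=> /and4P[ji /eqP wk /eqP wj /eqP wi] /comm2_e_neq0[w'k].
  rewrite !big_cons big_nil wk wj wi w'k !inE => /orP[] /eqP[w'i w'j];
    rewrite w'j w'i; [left|right; rewrite /mass /=; lia].
  by move=> p; rewrite !inE => /or3P[] /eqP->; rewrite ?wk ?wj ?wi.
Qed.

Definition factor_prod fs (a : nat -> A) : A :=
  foldr (fun f x => mul4 (factor_eval a f) x) (e l1) fs.

Lemma factor_prod_fits w fs : all (fits w) fs ->
  factor_prod fs (e \o w) = e l1.
Proof.
elim: fs => //= f fs IH /andP[/factor_eval_fits-> /IH->].
by apply: row4P; rewrite !mulE /=; ring.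
Qed.

(** A nonzero product has all its factors nonzero, so the comparisons of the factors add up. *)
Lemma factor_prod_mass w w' fs : all (fits w) fs ->
  factor_prod fs (e \o w') != 0 ->
  {in flatten (map positions fs), w =1 w'} \/
  (\sum_(p <- flatten (map positions fs)) mass p (w p) <
   \sum_(p <- flatten (map positions fs)) mass p (w' p))%N.
Proof.
elim: fs => [_ _|f fs IH /= /andP[wf wfs] ne0]; first by left.
have f0 : factor_eval (e \o w') f != 0.
  by apply: contraNneq ne0 => ->; rewrite linear0l.
have fs0 : factor_prod fs (e \o w') != 0.
  by apply: contraNneq ne0 => ->; rewrite linear0r.
rewrite !big_cat /=.
have eq_mass s : {in s, w =1 w'} ->
    (\sum_(p <- s) mass p (w p) = \sum_(p <- s) mass p (w' p))%N.
  by move=> ww'; rewrite !big_seq; apply: eq_bigr => p /ww'->.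
have [ff|flt] := factor_eval_mass wf f0; have [ffs|fslt] := IH wfs fs0.
- by left=> p; rewrite mem_cat => /orP[/ff|/ffs].
- by right; rewrite (eq_mass _ ff) ltn_add2l.
- by right; rewrite (eq_mass _ ffs) ltn_add2r.
- by right; rewrite -addSn leq_add // ltnW.
Qed.

Lemma poly_fun_factor f : poly_fun mul4 (positions f) (factor_eval^~ f).
Proof.
have C s1 s2 g1 g2 : poly_fun mul4 s1 g1 -> poly_fun mul4 s2 g2 ->
    poly_fun mul4 (s1 ++ s2) (fun a => comm (g1 a) (g2 a)).
  move=> g1P g2P; apply: poly_funB; first exact: poly_funM.
  apply: (@poly_fun_perm _ _ _ (s2 ++ s1)); first by rewrite perm_catC.
  exact: poly_funM.
case: f => [i|j i|k j i]; first exact: poly_fun_var.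
  by apply: (C [:: j] [:: i]); apply: poly_fun_var.
apply: (C [:: k] [:: j; i]); first exact: poly_fun_var.
apply: (@poly_fun_perm _ _ _ [:: i; j]).
  by rewrite (perm_catC [:: i] [:: j]).
by apply: (C [:: i] [:: j]); apply: poly_fun_var.
Qed.

(** The empty product is the constant [1], which no nonassociative monomial represents; otherwise
    the trailing unit is absorbed by the last factor. *)
Lemma poly_fun_factors fs : (0 < size fs)%N ->
  poly_fun mul4 (flatten (map positions fs)) (factor_prod fs).
Proof.
elim: fs => // f [_ _|f' fs IH _] /=.
  rewrite cats0; apply: poly_fun_ext (poly_fun_factor f) => a.
  by apply: row4P; rewrite !mulE /=; ring.
by apply: poly_funM; [exact: poly_fun_factor|exact: IH].
Qed.

End Factors.

(** * Walks and the lower bound for the codimensions *)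

(* Words read as walks on the heights 0, 1, 2, ... starting at 0:
   the letter [a] goes one up, [b] one down, [c] two down. *)
Fixpoint walks (n h : nat) : seq (seq 'I_4) :=
  if n is n'.+1 then
    [seq rcons s l1 | s <- walks n' h]
    ++ (if h is h'.+1 then [seq rcons s la | s <- walks n' h'] else [::])
    ++ [seq rcons s lb | s <- walks n' h.+1]
    ++ [seq rcons s lc | s <- walks n' h.+2]
  else if h is 0 then [:: [::]] else [::].

Variant walks_spec n h : seq 'I_4 -> Prop :=
  | WalkFlat s of s \in walks n h : walks_spec n h (rcons s l1)
  | WalkUp h' s of h = h'.+1 & s \in walks n h' : walks_spec n h (rcons s la)
  | WalkDown s of s \in walks n h.+1 : walks_spec n h (rcons s lb)
  | WalkDown2 s of s \in walks n h.+2 : walks_spec n h (rcons s lc).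

Lemma walksSP n h s : s \in walks n.+1 h -> walks_spec n h s.
Proof.
rewrite /= !mem_cat => /or4P[/mapP[s' ? ->]||/mapP[s' ? ->]|/mapP[s' ? ->]].
- exact: WalkFlat.
- by case: h => // h /mapP[s' ? ->]; apply: WalkUp.
- exact: WalkDown.
- exact: WalkDown2.
Qed.

Lemma walks_uniq n h : uniq (walks n h).
Proof.
elim: n h => [[]//|n IH] h.
have U l h' : uniq [seq rcons s l | s <- walks n h'].
  by rewrite map_inj_uniq //; exact: rcons_injl.
have D l l' h1 h2 : l != l' ->
    ~~ has (mem [seq rcons s l | s <- walks n h1])
           [seq rcons s l' | s <- walks n h2].
  move=> ll'; apply/hasPn => _ /mapP[s _ ->]; apply/negP => /mapP[s' _].
  by move=> /rcons_inj[_ /esym/eqP]; rewrite (negPf ll').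
have E : uniq ([seq rcons s lb | s <- walks n h.+1]
                ++ [seq rcons s lc | s <- walks n h.+2]).
  by rewrite cat_uniq !U D.
case: h E => [|h] E; rewrite [walks _ _]/=.
  by rewrite cat_uniq U has_cat negb_or !D.
by rewrite 2!cat_uniq !U !has_cat !negb_or !D.
Qed.

Lemma size_walk n h s : s \in walks n h -> size s = n.
Proof.
elim: n h s => [[|h]|n IH h] s; [by rewrite inE => /eqP->|by []|].
by case/walksSP=> [s' /IH|h' s' _ /IH|s' /IH|s' /IH]; rewrite size_rcons => ->.
Qed.

(** For every letter, weight plus rise in height equals 1. *)
Lemma wt_walk n h s : s \in walks n h -> (\sum_(l <- s) wt l + h = n)%N.
Proof.
elim: n h s => [[|h]|n IH h] s //.
  by rewrite inE => /eqP->; rewrite big_nil.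
case/walksSP=> [s' /IH|h' s' -> /IH|s' /IH|s' /IH];
  rewrite -cats1 big_cat big_seq1 /wt /=; lia.
Qed.

(** The list [st] is a stack of the positions of unmatched letters [a], its size being the height:
    [a] pushes, [b] pops one position, [c] pops two. *)
Lemma walk_factors n h s : s \in walks n h -> exists st fs,
  [/\ size st = h, all (fun p => nth l1 s p == la) st,
      all (fits (nth l1 s)) fs
    & perm_eq (st ++ flatten (map positions fs)) (iota 0 n)].
Proof.
elim: n h s => [[|h]|n IH h] s; [|by []|].
  by rewrite inE => /eqP->; exists [::], [::].
(* Appending a letter at position [n] changes no earlier letter; recording [p < n] for the stack
   supplies the order required by [fits]. *)
have extend s' h' l : s' \in walks n h' -> exists st fs,
    [/\ size st = h',
        all (fun p => (p < n)%N && (nth l1 (rcons s' l) p == la)) st,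
        all (fits (nth l1 (rcons s' l))) fs
      & perm_eq (st ++ flatten (map positions fs)) (iota 0 n)]
    /\ nth l1 (rcons s' l) n = l.
  move=> s'n; have s's := size_walk s'n.
  have nthE p : (p < n)%N -> nth l1 (rcons s' l) p = nth l1 s' p.
    by move=> pn; rewrite nth_rcons s's pn.
  have [st [fs [sth stl fsf pe]]] := IH _ _ s'n.
  have lt_n p : p \in st ++ flatten (map positions fs) -> (p < n)%N.
    by rewrite (perm_mem pe) mem_iota.
  exists st, fs; split; last by rewrite nth_rcons s's ltnn eqxx.
  split=> //.
    apply/allP => p pst; have pn : (p < n)%N by rewrite lt_n // mem_cat pst.
    by rewrite pn nthE //; exact: (allP stl).
  rewrite (@eq_all_fits _ (nth l1 s')) // => p pf.
  by rewrite nthE // lt_n // mem_cat pf orbT.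
have /permP iotaS : perm_eq (iota 0 n.+1) (n :: iota 0 n).
  by rewrite -addn1 iotaD add0n cats1 perm_rcons.
case/walksSP=> [s'|h' s' ->|s'|s'] /extend E.
- have [st [fs [[sth stl fsf /permP pe] s'n]]] := E l1.
  exists st, (Single n :: fs); split=> //=.
    by apply: sub_all stl => p /andP[].
    by rewrite s'n eqxx.
  by apply/permP => x; rewrite iotaS /= -pe !count_cat /=; lia.
- have [st [fs [[sth stl fsf /permP pe] s'n]]] := E la.
  exists (n :: st), fs; split=> //=; first by rewrite sth.
    by rewrite s'n eqxx; apply: sub_all stl => p /andP[].
  by apply/permP => x; rewrite iotaS /= -pe !count_cat /=; lia.
- have [[|j st] [fs [[//[sth] /=]]]] := E lb.
  move=> /andP[/andP[jn jl] stl] fsf /permP pe s'n.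
  exists st, (Pair j n :: fs); split=> //=.
    by apply: sub_all stl => p /andP[].
    by rewrite jn jl s'n eqxx.
  by apply/permP => x; have := pe x; rewrite iotaS /= !count_cat /=; lia.
- have [[|k [|j st]] [fs [[//[sth] /=]]]] := E lc.
  move=> /and3P[/andP[_ kl] /andP[jn jl] stl] fsf /permP pe s'n.
  exists st, (Triple k j n :: fs); split=> //=.
    by apply: sub_all stl => p /andP[].
    by rewrite jn kl jl s'n eqxx.
  by apply/permP => x; have := pe x; rewrite iotaS /= !count_cat /=; lia.
Qed.

Lemma walks_le_codimension (F : fieldType) n : (0 < n)%N ->
  (size (walks n 0) <= codimension (@mul4 F) n)%N.
Proof.
move=> n0; pose s (i : 'I_(size (walks n 0))) := nth [::] (walks n 0) i.
have sW i : s i \in walks n 0 by exact: mem_nth.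
have sz i : size (s i) == n by rewrite (size_walk (sW i)).
have /choice[fs fsP] : forall i, exists fs, all (fits (nth l1 (s i))) fs /\
    perm_eq (flatten (map positions fs)) (iota 0 n).
  move=> i; have [st [fs [/size0nil st0 _ fsf]]] := walk_factors (sW i).
  by rewrite st0 => pe; exists fs.
have /choice[f fP] : forall i, exists f, multilinear_polys F n f /\
    forall a, poly_eval (@mul4 F) a f = factor_prod (fs i) a.
  move=> i; have [fsf pe] := fsP i.
  have [|f fn fE] := @poly_fun_multilinear _ _ (@mul4 F) n (factor_prod (fs i)).
    apply: (poly_fun_perm pe); apply: poly_fun_factors.
    by case: (fs i) pe => // /perm_size; rewrite size_iota /=; lia.
  by exists f.
have word_bound i : (\sum_(l <- Tuple (sz i)) wt l <= n.+2)%N.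
  by have := wt_walk (sW i) => /=; lia.
pose x i : words n := exist _ (Tuple (sz i)) (word_bound i).
apply: (@free_le_dim_mod _ _ _ _ _ (@word_eval F n)) (fun i => (fP i).1) _.
- exact: word_eval_is_scalar.
- exact: multilinear_polys0.
- exact: multilinear_polys_lin.
- exact: word_evalP.
move=> c c0.
(* Each product takes the value [1] at its own word, and it is nonzero only there or at words of
   larger mass. *)
apply: (@triangular_free _ _ (fun i j => word_eval (x j) (f i))
  (fun i => \sum_(p <- iota 0 n) mass p (nth l1 (s i) p))%N) => [i|i j|j].
- rewrite /word_eval (fP i).2 /= factor_prod_fits ?(fsP i).1 //.
  rewrite (bigD1 l1) //= big1 ?addr0 => [|k k0]; rewrite eE ?oner_neq0 //.
  by rewrite val_eqE (negPf k0).
- rewrite /word_eval (fP i).2 /= => ne0.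
  have {}ne0 : factor_prod (fs i) (@e F \o nth l1 (s j)) != 0.
    by apply: contraNneq ne0 => ->; rewrite big1 // => k _; rewrite mxE.
  have [fsf pe] := fsP i.
  have := factor_prod_mass fsf ne0; rewrite !(perm_big _ pe) /=.
  case=> [ij|]; [left|by right].
  (* The positions exhaust all indices below [n], so both words agree, and the list of walks has no
     repetitions. *)
  apply/val_inj/eqP; rewrite -(nth_uniq [::] _ _ (walks_uniq n 0)) ?ltn_ord //.
  apply/eqP/(@eq_from_nth _ l1); rewrite (eqP (sz i)) ?(eqP (sz j)) // => p pn.
  by apply: ij; rewrite (perm_mem pe) mem_iota.
- exact: c0.
Qed.

Lemma size_walksS n h : size (walks n.+1 h) =
  (size (walks n h) + (if h is h'.+1 then size (walks n h') else 0)
   + size (walks n h.+1) + size (walks n h.+2))%N.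
Proof.
by case: h => [|h]; rewrite [walks _ _]/= !size_cat !size_map ?addn0 ?addnA.
Qed.

(** A walk may climb straight to [h] and then stay flat. *)
Lemma walks_gt0 n h : (h <= n)%N -> (0 < size (walks n h))%N.
Proof.
elim: n h => [[]//|n IH] h; rewrite leq_eqVlt => /predU1P[->|].
  by rewrite size_walksS; have := IH n (leqnn n); lia.
by rewrite ltnS => /IH; rewrite size_walksS; lia.
Qed.

(** * Exponential growth rates *)

Lemma geometric_dominated (R : realType) (C x y : R) : 0 <= x < y ->
  \forall n \near \oo, C * x ^+ n <= y ^+ n.
Proof.
move=> /andP[x0 xy]; have y0 : 0 < y by exact: le_lt_trans xy.
have : `|x / y| < 1.
  by rewrite ger0_norm ?divr_ge0 ?(ltW y0) // ltr_pdivrMr // mul1r.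
move=> /cvg_expr /cvgrPdist_lt /(_ (`|C| + 1)^-1).
have C0 : 0 < `|C| + 1 by rewrite ltr_wpDl.
rewrite invr_gt0 => /(_ C0); apply: filterS => n.
rewrite sub0r normrN expr_div_n ger0_norm ?divr_ge0 ?exprn_ge0 ?(ltW y0) //.
have yn := exprn_gt0 n y0.
rewrite ltr_pdivrMr // ltr_pdivlMl // => lt.
apply: le_trans (ltW lt); rewrite ler_wpM2r ?exprn_ge0 //.
by rewrite (le_trans (ler_norm C)) // lerDl.
Qed.

Lemma cvg_root (R : realType) (u : nat -> R) (l : R) : 0 < l ->
  (forall x, l < x -> \forall n \near \oo, u n <= x ^+ n) ->
  (forall x, 0 < x < l -> \forall n \near \oo, x ^+ n <= u n) ->
  (fun n => u n `^ n%:R^-1) @ \oo --> l.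
Proof.
move=> l0 up low; apply/cvgrPdist_le => eps eps0.
(* The cap [l / 2] keeps [l - d] positive, as the lower bound requires. *)
pose d := Num.min eps (l / 2).
have d0 : 0 < d by rewrite lt_min eps0 divr_gt0.
have dl : d < l by rewrite gt_min; apply/orP; right; lra.
have de : d <= eps by rewrite ge_min lexx.
near=> n.
have n0 : (0 < n)%N by near: n; exact: nbhs_infty_gt.
have root (z : R) : 0 <= z -> (z ^+ n) `^ n%:R^-1 = z.
  move=> z0; rewrite -powR_mulrn // -powRrM mulfV ?powRr1 //.
  by rewrite pnatr_eq0 -lt0n.
have un : u n <= (l + eps) ^+ n by near: n; apply: up; rewrite ltrDl.
have ln : (l - d) ^+ n <= u n.
  by near: n; apply: low; rewrite subr_gt0 dl ltrBlDr ltrDl.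
have ld0 : 0 <= l - d by rewrite subr_ge0 ltW.
have u0 : 0 <= u n by apply: le_trans ln; rewrite exprn_ge0.
have mono (y z : R) : 0 <= y -> y <= z -> y `^ n%:R^-1 <= z `^ n%:R^-1.
  by move=> y0 yz; rewrite ge0_ler_powR // ?nnegrE ?invr_ge0 ?(le_trans y0).
have := mono _ _ u0 un; rewrite root ?addr_ge0 ?(ltW l0) ?(ltW eps0) //.
have := mono _ _ (exprn_ge0 n ld0) ln; rewrite root //.
by rewrite ler_distlC; lra.
Unshelve. all: by end_near.
Qed.

Section WalkGrowth.
Variables (R : realType) (t : R).
Hypothesis t01 : 0 < t <= 1.
(* The minimum of [1 + t^-1 + t + t ^+ 2] over [t > 0], the common growth rate
   of words of bounded weight and of walks, is attained where its derivative
   vanishes.  This makes the walk, weighted by powers of [t], driftless. *)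
Hypothesis t_crit : 2 * t ^+ 3 + t ^+ 2 = 1.

(* This is [1 + t^-1 + t + t ^+ 2], because [t^-1 = t + 2 * t ^+ 2]. *)
Definition rate : R := 1 + 2 * t + 3 * t ^+ 2.

(** The second moment of the displacements 0, -1, 1, 2 with weights [1], [t^-1], [t], [t ^+ 2],
    rewritten by [t^-1 = t + 2 * t ^+ 2]. *)
Let variance : R := 2 * t + 6 * t ^+ 2.

Let t0 : 0 < t. Proof. by case/andP: t01. Qed.

Lemma rateE : t * rate = t + 1 + t ^+ 2 + t ^+ 3.
Proof. by rewrite /rate; move: t_crit; lra. Qed.

(* The concave weight [(h + 1) (H + 1 - h)] vanishes at the heights -1 and
   [H + 1] and is negative beyond, so it is a subsolution up to the variance
   of one step. *)
Lemma walks_ge H n h : variance <= rate * H.+1%:R ->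
  t ^+ h * (h.+1%:R * (H.+1%:R - h%:R))
    * (rate - variance / H.+1%:R) ^+ n <=
  H.+1%:R ^+ 2 * (size (walks (H + n) h))%:R.
Proof.
set K : R := H.+1%:R; set mu := rate - _ => varK.
have K0 : 0 < K by rewrite ltr0n.
have mu0 : 0 <= mu by rewrite subr_ge0 ler_pdivrMr.
(* Above height [H] the left side is nonpositive. *)
have neg i m : (H < i)%N -> t ^+ i * (i.+1%:R * (K - i%:R)) * mu ^+ m <=
    K ^+ 2 * (size (walks (H + m) i))%:R.
  move=> Hi; apply: (@le_trans _ _ 0); last by rewrite mulr_ge0 ?sqr_ge0.
  rewrite mulr_le0_ge0 ?exprn_ge0 // mulr_ge0_le0 ?exprn_ge0 ?(ltW t0) //.
  by rewrite mulr_ge0_le0 // subr_le0 ler_nat.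
elim: n h => [|n IH] h; (have [Hh|hH] := ltnP H h; first exact: neg).
  (* The [H] preliminary steps ensure that every height up to [H] is reached at the start of the
     induction. *)
  have N1 : 1 <= (size (walks (H + 0) h))%:R :> R.
    by rewrite ler1n walks_gt0 // addn0.
  rewrite expr0 mulr1; apply: (@le_trans _ _ (K ^+ 2)); last first.
    by rewrite ler_peMr ?sqr_ge0.
  have Kh : 0 <= K - h%:R by rewrite subr_ge0 ler_nat ltnW.
  rewrite -[leRHS]mul1r; apply: ler_pM.
  - by rewrite exprn_ge0 // ltW.
  - by rewrite mulr_ge0.
  - by rewrite exprn_ile1 ?(ltW t0) //; case/andP: t01.
  - by rewrite expr2 ler_pM ?ler_nat // lerBlDr lerDl.
rewrite addnS size_walksS !natrD !mulrDr.
set x : R := h%:R; have x0 : 0 <= x by rewrite ler0n.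
have xH : x <= K - 1 by rewrite /K -natr1 addrK ler_nat.
set s := t ^+ h; have s0 : 0 < s by rewrite exprn_gt0.
have m0 : 0 <= mu ^+ n by rewrite exprn_ge0.
have y0 := IH h; have y1 := IH h.+1; have y2 := IH h.+2.
(* The contribution of up-steps; at height 0 the factor [x] vanishes, matching the absence of walks
   from below. *)
have ym : s * (t + 2 * t ^+ 2) * (x * (K - x + 1)) * mu ^+ n <=
    K ^+ 2 * (if h is h'.+1 then size (walks (H + n) h') else 0)%:R.
  rewrite /s /x; case: (h) => [|h']; first by rewrite mul0r mulr0 mul0r mulr0.
  suff -> : t ^+ h'.+1 * (t + 2 * t ^+ 2) * (h'.+1%:R * (K - h'.+1%:R + 1)) =
      t ^+ h' * (h'.+1%:R * (K - h'%:R)) by exact: IH.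
  have tt : t * (t + 2 * t ^+ 2) = 1 by move: t_crit; lra.
  rewrite exprSr -(mulrA _ t) tt mulr1 -[in LHS]natr1; ring.
apply: le_trans (lerD (lerD (lerD y0 ym) y1) y2).
rewrite -!mulrDl exprSr mulrA mulrAC ler_wpM2r //.
rewrite !exprS -/s -!natr1 -/x.
(* Between 0 and [K - 1] the weight [(x + 1) * (K - x)] is at least [K], so lowering the rate by
   [variance / K] pays for the loss [variance]. *)
have step : (x + 1) * (K - x) * mu <= rate * ((x + 1) * (K - x)) - variance.
  have : variance / K * K <= variance / K * ((x + 1) * (K - x)).
    apply: ler_wpM2l; last first.
      have : 0 <= x * (K - 1 - x) by rewrite mulr_ge0 // subr_ge0.
      by lra.
    rewrite divr_ge0 ?(ltW K0) // /variance.
    by have := exprn_gt0 2 t0; move: t0; lra.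
  rewrite divfK ?gt_eqF // /mu => vK; rewrite mulrBr mulrC lerD2l lerN2 mulrC.
  exact: vK.
have := ler_wpM2l (ltW s0) step; rewrite /rate /variance.
by move=> lr; apply: le_trans (le_trans _ lr) _; rewrite le_eqVlt;
  apply/orP; left; apply/eqP; ring.
Qed.

Lemma walks0_ge H n : variance <= rate * H.+1%:R ->
  (rate - variance / H.+1%:R) ^+ n <=
  H.+1%:R * (size (walks (H + n) 0))%:R.
Proof.
move=> /(walks_ge n 0); rewrite expr0 !mul1r subr0 expr2 -mulrA.
by rewrite ler_pM2l // ltr0n.
Qed.

Lemma card_words_le_rate n : #|{: words n}|%:R * t ^+ 2 <= rate ^+ n.
Proof.
have := card_words_le n t01; rewrite -rateE exprMn.
rewrite (_ : t ^+ n.+2 = t ^+ n * t ^+ 2); last by rewrite -exprD addn2.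
rewrite mulrCA.
by rewrite ler_pM2l // exprn_gt0.
Qed.

Lemma cvg_codim_root (F : fieldType) : codim_root (@mul4 F) R @ \oo --> rate.
Proof.
have t2 : 0 < t ^+ 2 by rewrite exprn_gt0.
have rate1 : 1 < rate by rewrite /rate; move: t0 t2; lra.
have rate0 : 0 < rate by exact: lt_trans rate1.
apply: (@cvg_root _ (fun n => (codimension (@mul4 F) n)%:R)) => // x.
  move=> ratex; have : 0 <= rate < x by rewrite ltW.
  move=> /(geometric_dominated (t ^+ 2)^-1); apply: filterS => n.
  apply: le_trans; rewrite ler_pdivlMl // mulrC.
  apply: le_trans (card_words_le_rate n).
  by rewrite ler_pM2r // ler_nat codimension_mul4_le.
move=> /andP[x0 xrate].
have rx : 0 < rate - x by rewrite subr_gt0.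
have var0 : 0 <= variance by rewrite /variance; move: t0 t2; lra.
(* The strip is tall enough for [rate - variance / H.+1%:R] to exceed [x]. *)
pose H := Num.truncn (variance / (rate - x)).
have H0 : 0 < H.+1%:R :> R by rewrite ltr0n.
have varH : variance < (rate - x) * H.+1%:R.
  by rewrite -ltr_pdivrMl // mulrC truncnS_gt.
set mu := rate - variance / H.+1%:R.
have xmu : x < mu by rewrite ltrBrDl -ltrBrDr ltr_pdivrMr.
have : 0 <= x < mu by rewrite ltW.
(* The constant covers the factor [H.+1] of [walks0_ge] and the [H] preliminary steps. *)
move=> /(geometric_dominated (H.+1%:R * x ^+ H))[M _ HM].
exists (H.+1 + M)%N => // n /= HMn.
have Hn : (H < n)%N by apply: leq_trans HMn; rewrite leq_addr.
have -> : n = (H + (n - H))%N by rewrite subnKC // ltnW.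
rewrite exprD -(ler_pM2l H0) mulrA; apply: le_trans (HM _ _) _ => /=.
  by rewrite leq_subRL ?(ltnW Hn) // (leq_trans _ HMn) // leq_add2r.
apply: le_trans (walks0_ge _ _) _.
  by apply: (le_trans (ltW varH)); rewrite ler_wpM2r // gerBl ltW.
by rewrite ler_pM2l // ler_nat walks_le_codimension // addn_gt0 subn_gt0
  Hn orbT.
Qed.

End WalkGrowth.

(** The polynomial is -0.208 and 0.176 at the endpoints, where [rate] is 3.28 and 3.87; this
    interval keeps [rate] strictly between 3 and 4. *)
Lemma ex_critical_point (R : realType) :
  exists2 t : R, 3 / 5 <= t <= 7 / 10 & 2 * t ^+ 3 + t ^+ 2 = 1.
Proof.
pose p : {poly R} := 2%:P * 'X^3 + 'X^2 - 1%:P.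
have pE x : p.[x] = 2 * x ^+ 3 + x ^+ 2 - 1 by rewrite /p !hornerE.
have [|| t tI /rootP] := @poly_ivt R p (3 / 5) (7 / 10).
- lra.
- by rewrite !pE; apply/andP; split; lra.
by rewrite pE => /eqP; rewrite subr_eq0 => /eqP; exists t.
Qed.

Theorem mainTheorem2 (R : realType) (F : fieldType)
    (charF : [pchar F] =i pred0) :
  exists (A : vectType F) (mul : {bilinear A -> A -> A}),
    [/\ simple_algebra mul,
        unital mul,
        cvgn (codim_root mul R),
        PIexp mul R \isn't a Num.int
      & PIexp mul R < (\dim (fullv : {vspace A}))%:R].
Proof.
have [t /andP[tge tle] t_crit] := ex_critical_point R.
have t01 : 0 < t <= 1 by apply/andP; split; lra.
have cvg_rate := cvg_codim_root t01 t_crit F.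
have PIexpE : PIexp (@mul4 F) R = rate t by exact/cvg_lim.
have rate_gt3 : 3 < rate t by rewrite /rate; nra.
have rate_lt4 : rate t < 4 by rewrite /rate; nra.
exists 'rV[F]_4, (@mul4 F); split.
- exact: mul4_simple.
- exact: mul4_unital.
- by apply/cvg_ex; exists (rate t).
- rewrite PIexpE; apply/negP => /intrP[m mE].
  move: rate_gt3 rate_lt4; rewrite mE -[3]/(3%:~R) -[4]/(4%:~R) !ltr_int; lia.
- by rewrite PIexpE dimvf dim_matrix.
Qed.
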